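(* Let $\mathbf a=(a_1,\dots,a_n)$ be the truthful profile, let $\tau$ be the deadline, and let $\mathbf b$ be the ballot profile induced by $\mathbf a$, i.e. $b_i=\mathrm{top}_i(C)$. Consider $CUD(\mathcal F^{IMaj}_\sigma,\tau)$ with $\frac n2<\sigma\le n$. If there is an alternative $c\in C^+$ whose score $\mathrm{sc}_c(\mathbf b)=|\{i\in V: b_i=c\}|$ satisfies $$\mathrm{sc}_c(\mathbf b)\ \ge\ \max\left\{\left\lfloor\tfrac n2\right\rfloor+1,\ \sigma-\tau\right\},$$ then the CUD terminates with $c$ as the winner.
   Context: Setting (Consensus Under a Deadline, CUD). $V=\{1,\dots,n\}$ is a finite set of $n$ voters, $C$ is a finite set of $m+1$ alternatives containing a default alternative $\psi$; $C^+=C\setminus\{\psi\}$ is the set of valid alternatives ($|C^+|=m\ge 1$). Each voter $i$ has a truthful preference $a_i$, a strict linear order on $C$; $a_i(c,c')$ means that $i$ prefers $c$ to $c'$. It is assumed that $a_i(c,\psi)$ for all $i\in V$, $c\in C^+$. For nonempty $W\subseteq C$, $\mathrm{top}_i(W)$ is the $a_i$-best element of $W$. The deadline $\tau$ is a nonnegative integer and the threshold $\sigma$ is an integer with $\frac n2<\sigma\le n$. Time $t$ counts the remaining steps, running down from $\tau$ to $0$. Scores. For a ballot profile $b^t=(b^t_1,\dots,b^t_n)\in C^n$, $s^t_c=|\{i\in V: b^t_i=c\}|$, and $s^t=(s^t_c)_{c\in C^+}$ is the score vector. For a score vector $s$ and $c\in C$, $s+c$ (resp. $s-c$) is $s$ with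 the score of $c$ increased (resp. decreased) by 1. Possible winners and voting rule. $\widehat W(s,t)=\{c\in C^+ : \sigma-s_c<t+1\}$ is the set of possible winners. $\mathcal F(s,t)=\mathcal F^{IMaj}_\sigma(s,t)$ equals $\{\psi\}$ if $\widehat W(s,t)=\emptyset$ and equals $\widehat W(s,t)$ otherwise. Utilities. Each voter has a utility $u_i(s,t)\in\mathbb R$ on score vectors $s$ and times $t\in\{0,\dots,\tau\}$. With $w=\mathrm{top}_i(\mathcal F(s,t))$ and $w'=\mathrm{top}_i(\mathcal F(s',t))$: $u_i$ is lazy consistent if for all $s,s',t$: $u_i(s,t)>u_i(s',t)\iff a_i(w,w')$; $u_i$ is proactive consistent if for all $s,s',t$: $u_i(s,t)>u_i(s',t)\iff a_i(w,w')$ or ($w=w'$ and $s_w>s'_w$), where for $w=w'=\psi$ neither side is strictly better. Either all voters are lazy consistent or all are proactive consistent. Process. Initially $t=\tau$ and $b^\tau_i=\mathrm{top}_i(C)$ for all $i$. At time $t$: if $\mathcal F(s^t,t)=\{w\}$ is a singleton, the process stops and $w$ is the outcome (the winner if $w\in C^+$; the default if $w=\psi$). Otherwise each voter $i$ computes a best response $w_i\in\arg\max_{c\in C}u_i(s^t-b^t_i+c,\,t-1)$, where $w_i=b_i^t$ if $b_i^t$ is itself a maximizer (a voter changes only for a strict improvement), and otherwise ties among maximizers are broken by $a_i$ (the $a_i$-best maximizer is chosen). Let $I=\{i: w_i\ne b^t_i\}$. If $I\neq\emptyset$, one $j\in I$ is chosen uniformly at random and $b^{t-1}_j=w_j$,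 $b^{t-1}_i=b^t_i$ for $i\ne j$; if $I=\emptyset$, $b^{t-1}=b^t$. Then $t$ is replaced by $t-1$. At $t=0$ the set $\mathcal F(s^0,0)$ is always a singleton because $\sigma>n/2$. A run is any realization of the random choices; the statement holds for every run. *)

(* Defs.v *)
From HB Require Import structures.
From mathcomp Require Import all_boot all_order all_algebra.
From mathcomp Require Import reals.

Set Implicit Arguments.
Unset Strict Implicit.
Unset Printing Implicit Defensive.

Import Order.TTheory GRing.Theory Num.Theory.

Definition strict_linear_order (T : eqType) (r : rel T) : Prop :=
  [/\ irreflexive r, transitive r & forall x y, x != y -> r x y || r y x].

Section CUD.

(* [psi] is the default alternative, [sigma] the threshold, [tau] the deadline. *)
Variables (R : realType) (C : finType) (psi : C) (n sigma tau : nat).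

Definition valid := {c : C | c != psi}.

Definition profile := {ffun 'I_n -> C}.

Definition scores := {ffun valid -> nat}.

Definition score (b : profile) : scores :=
  [ffun d => #|[set i | b i == val d]|].

(* Score vectors have no [psi]-coordinate, so adding or removing a vote for
   [psi] leaves them unchanged. *)
Definition score_add (s : scores) (c : C) : scores :=
  [ffun d => s d + (val d == c)].

(* Truncated subtraction is exact here: a ballot is only removed from a score
   vector in which it is counted. *)
Definition score_sub (s : scores) (c : C) : scores :=
  [ffun d => s d - (val d == c)].

(* [r x y] reads "x is preferred to y"; the value on the empty set is
   irrelevant. *)
Definition top (r : rel C) (W : {set C}) : C :=
  odflt psi [pick c in W | [forall c' in W, (c' != c) ==> r c c']].

(* Truncation of [sigma - s d] at 0 does not affect the comparison, since the
   right-hand side is positive. *)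
Definition possible_winners (s : scores) (t : nat) : {set C} :=
  [set val d | d : valid & sigma - s d < t + 1].

Definition imaj (s : scores) (t : nat) : {set C} :=
  if possible_winners s t == set0 then [set psi] else possible_winners s t.

(* Score vectors are those of ballot profiles of the [n] voters, and times are
   at most [tau]; utilities are unconstrained elsewhere. *)
Definition lazy_consistent (r : rel C) (v : scores -> nat -> R) : Prop :=
  forall (b b' : profile) (t : nat), t <= tau ->
    let s := score b in let s' := score b' in
    let w := top r (imaj s t) in let w' := top r (imaj s' t) in
    (v s' t < v s t)%R <-> r w w'.

(* Quantifying [d] over valid alternatives makes the second disjunct false when
   both tops are [psi]. *)
Definition proactive_consistent (r : rel C) (v : scores -> nat -> R) : Prop :=
  forall (b b' : profile) (t : nat), t <= tau ->
    let s := score b in let s' := score b' in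
    let w := top r (imaj s t) in let w' := top r (imaj s' t) in
    (v s' t < v s t)%R <->
    (r w w' \/ exists d : valid, [/\ w = val d, w' = val d & s' d < s d]).

Variables (a : 'I_n -> rel C) (u : 'I_n -> scores -> nat -> R).

Definition truthful : profile := [ffun i => top (a i) [set: C]].

Definition response_utility (b : profile) (t : nat) (i : 'I_n) (c : C) : R :=
  u i (score_add (score_sub (score b) (b i)) c) t.-1.

Definition maximizers (b : profile) (t : nat) (i : 'I_n) : {set C} :=
  [set c | [forall c', (response_utility b t i c'
                        <= response_utility b t i c)%R]].

Definition best_response (b : profile) (t : nat) (i : 'I_n) : C :=
  if b i \in maximizers b t i then b i else top (a i) (maximizers b t i).

Definition movers (b : profile) (t : nat) : {set 'I_n} :=
  [set i | best_response b t i != b i].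

(* [step t b b']: from ballots [b] at time [t > 0], some realization of the
   random choice of a mover yields the ballots [b'] at time [t - 1]. *)
Definition step (t : nat) (b b' : profile) : Prop :=
  if movers b t == set0 then b' = b
  else exists2 j, j \in movers b t &
         b' = [ffun i => if i == j then best_response b t j else b i].

Definition stopping (b : profile) (t : nat) : bool :=
  #|imaj (score b) t| == 1.

(* [beta t] is the ballot profile when [t] steps remain; it is constrained only
   as long as the process has not stopped at an earlier (larger) time. *)
Definition run (beta : nat -> profile) : Prop :=
  beta tau = truthful /\
  forall t, t < tau ->
    (forall t', t < t' <= tau -> ~~ stopping (beta t') t') ->
    step t.+1 (beta t.+1) (beta t).

Definition terminates_with (beta : nat -> profile) (w : C) : Prop :=
  exists T, [/\ T <= tau,
    forall t, T < t <= tau -> ~~ stopping (beta t) t &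
    imaj (score (beta T)) T = [set w]].

End CUD.

(* Main.v *)
Require Import Defs.
From HB Require Import structures.
From mathcomp Require Import all_boot all_order all_algebra.
From mathcomp Require Import reals.
From mathcomp Require Import zify.

(** Let [N] be the set of voters who rank [c] first, so that [n < 2 * #|N|].
As long as the process has not stopped, all of [N] votes for [c] and
[sigma <= #|N| + t].  Indeed, if [c] is a possible winner at time [t] and the
process does not stop, then some [d != c] is a possible winner too; since [d]
has at most [n - #|N| < #|N|] votes, [sigma <= #|N| + (t - 1)], so a voter of
[N] who keeps voting for [c] keeps [c] among the next possible winners, which
she cannot improve upon.  At time 0 no [d != c] can be a possible winner. *)

Set Implicit Arguments.
Unset Strict Implicit.
Unset Printing Implicit Defensive.

(** The fallback of [imaj] to the default contributes only [psi], so it never affects a valid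
    alternative. *)
Lemma imajE (C : finType) (psi : C) sigma (s : scores psi) t (d : valid psi) :
  (val d \in imaj sigma s t) = (sigma <= s d + t).
Proof.
have winE : (val d \in possible_winners sigma s t) = (sigma <= s d + t).
  rewrite /possible_winners mem_imset; last exact: val_inj.
  by rewrite inE; apply/idP/idP; lia.
rewrite /imaj; case: eqP => [w0|_] //.
by rewrite -winE w0 !inE (negPf (valP d)).
Qed.

Section Top.
Variables (C : finType) (psi : C) (r : rel C).
Hypothesis r_order : strict_linear_order r.

Lemma top_max (W : {set C}) c :
  c \in W -> (forall d, d != c -> r c d) -> top psi r W = c.
Proof.
case: r_order => irr tr _ cW cmax; rewrite /top; case: pickP => [d|none] /=.
  case/andP=> _ /forallP/(_ c); rewrite cW /=; case: (eqVneq c d) => //= cd rdc.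
  by have := tr _ _ _ rdc (cmax d _); rewrite irr eq_sym cd => /(_ isT).
have := none c; rewrite cW /=; move/forallP; case=> d.
by apply/implyP => _; apply/implyP => /cmax.
Qed.

(** Since [c != psi], the value [c] cannot be the one that [top] returns when its search fails. *)
Lemma topT_max c d : c != psi -> top psi r [set: C] = c -> d != c -> r c d.
Proof.
move=> hc; rewrite /top; case: pickP => [e|_] /=; last first.
  by move=> psic; rewrite psic eqxx in hc.
by case/andP=> _ /forallP/(_ d); rewrite inE /= => /implyP H <- /H.
Qed.

End Top.

Section Revote.
Variables (C : finType) (psi : C) (n : nat).
Implicit Type b : profile C n.

(** Consistency speaks only of scores of ballot profiles, so a deviation is realised as a profile
    before utilities are compared. *)
Definition revote b i c : profile C n :=
  [ffun j => if j == i then c else b j].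

Lemma score_revote b i c :
  score_add (score_sub (score psi b) (b i)) c = score psi (revote b i c).
Proof.
(* Voter [i] is split off both counts; her own vote is then subtracted exactly, despite
   truncation. *)
apply/ffunP => d; rewrite !ffunE (cardsD1 i) [RHS](cardsD1 i) !inE ffunE eqxx.
rewrite [val d == b i]eq_sym [val d == c]eq_sym addKn addnC; congr (_ + _).
apply: eq_card => j; rewrite !inE ffunE.
by case: (j == i).
Qed.

Lemma revote_id b i : revote b i (b i) = b.
Proof. by apply/ffunP => j; rewrite ffunE; case: eqP => // ->. Qed.

Lemma leq_score_revote b i c (d : valid psi) :
  b i = val d -> score psi (revote b i c) d <= score psi b d.
Proof.
move=> bi; rewrite !ffunE; apply/subset_leq_card/subsetP => j.
rewrite !inE ffunE; case: (eqVneq j i) => [->|] //.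
by rewrite bi eqxx.
Qed.

Lemma leq_card_score b (N : {set 'I_n}) (d : valid psi) :
  {in N, forall i, b i = val d} -> #|N| <= score psi b d.
Proof.
move=> bN; rewrite ffunE; apply/subset_leq_card/subsetP => i iN.
by rewrite inE bN.
Qed.

Lemma score_disjoint b (N : {set 'I_n}) c (d : valid psi) :
  {in N, forall i, b i = c} -> val d != c -> score psi b d + #|N| <= n.
Proof.
move=> bN dc; rewrite -[leqRHS]card_ord -(cardC N) addnC ffunE leq_add2l.
apply/subset_leq_card/subsetP => i; rewrite !inE => /eqP bi.
by apply/negP => /bN ci; rewrite -bi ci eqxx in dc.
Qed.

End Revote.

Section Process.
Variables (R : realType) (C : finType) (psi : C) (n sigma tau : nat).
Variables (a : 'I_n -> rel C) (u : 'I_n -> scores psi -> nat -> R).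
Hypothesis ha : forall i, strict_linear_order (a i).
Hypothesis hu : (forall i, lazy_consistent n sigma tau (a i) (u i)) \/
  (forall i, proactive_consistent n sigma tau (a i) (u i)).

(** Staying keeps [c], the favourite of [i], as the top of the next outcome. Only a proactive voter
    could still gain, by a higher score of [c], and leaving [c] never raises it. *)
Lemma best_response_stay (b : profile C n) t i (c : valid psi) :
    t < tau -> b i = val c -> (forall d, d != val c -> a i (val c) d) ->
    sigma <= score psi b c + t ->
  best_response a u b t.+1 i = b i.
Proof.
move=> tt bi cmax win; rewrite /best_response ifT // inE; apply/forallP => e.
rewrite /response_utility !score_revote revote_id /= Order.TotalTheory.leNgt.
apply/negP => better.
have topc : top psi (a i) (imaj sigma (score psi b) t) = val c.
  by apply: top_max => //; rewrite imajE.
have none x : ~ a i x (val c).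
  have [irr tr _] := ha i => xc; case: (eqVneq x (val c)) xc => [->|ne xc].
    by rewrite irr.
  by have := tr _ _ _ xc (cmax _ ne); rewrite irr.
case: hu => [/(_ i)/(_ (revote b i e) b t (ltnW tt))|
             /(_ i)/(_ (revote b i e) b t (ltnW tt))] /= [/(_ better) + _];
  rewrite topc; first exact: none.
(* Proactive tie-break: [val_inj] identifies [d] with [c], whose score would have to grow. *)
case=> [|[d [_ /val_inj <-]]]; first exact: none.
by rewrite ltnNge leq_score_revote.
Qed.

Variables (c : valid psi) (N : {set 'I_n}).
Hypothesis N_max : {in N, forall i d, d != val c -> a i (val c) d}.
Hypothesis N_major : n < 2 * #|N|.

Lemma step_stay (b b' : profile C n) t :
    t < tau -> sigma <= #|N| + t -> {in N, forall i, b i = val c} ->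
  step a u t.+1 b b' -> {in N, forall i, b' i = val c}.
Proof.
move=> tt win bN; rewrite /step; case: ifP => _ [] => [|j _] -> i iN.
  exact: bN.
rewrite ffunE; case: eqP => [<-|_]; last exact: bN.
rewrite (best_response_stay (c := c)) ?bN //; first exact: N_max.
apply: leq_trans win _; rewrite leq_add2r.
exact: leq_card_score.
Qed.

Lemma imaj_or_rival (b : profile C n) t :
    sigma <= #|N| + t -> {in N, forall i, b i = val c} ->
  imaj sigma (score psi b) t = [set val c] \/
  [/\ ~~ stopping psi sigma b t & sigma + #|N| <= n + t].
Proof.
move=> win bN; have cW : val c \in imaj sigma (score psi b) t.
  rewrite imajE; apply: leq_trans win _; rewrite leq_add2r.
  exact: leq_card_score.
case: (eqVneq (imaj sigma (score psi b) t) [set val c]) => [->|]; first by left.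
rewrite eqEsubset sub1set cW andbT => /subsetPn[d dW]; rewrite inE => dc.
right; split.
  apply/negP => /cards1P[x Ex]; move: cW dW dc.
  by rewrite Ex !inE => /eqP-> ->.
(* If the fallback had occurred, [imaj] would be [[set psi]] and could not contain [c]. *)
have dpsi : d != psi.
  move: dW; rewrite /imaj; case: eqP => [w0|_].
    by move: cW; rewrite /imaj w0 eqxx inE (negPf (valP c)).
  by case/imsetP=> e _ ->; exact: (valP e).
pose e : valid psi := exist _ d dpsi.
have : val e \in imaj sigma (score psi b) t := dW.
by rewrite imajE; have := score_disjoint (d := e) bN dc; lia.
Qed.

Lemma terminates_from (beta : nat -> profile C n) t :
    n < 2 * sigma -> run sigma tau a u beta -> t <= tau ->
    (forall t', t < t' <= tau -> ~~ stopping psi sigma (beta t') t') ->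
    sigma <= #|N| + t -> {in N, forall i, beta t i = val c} ->
  terminates_with psi sigma tau beta (val c).
Proof.
move=> hsigma [_ steps]; elim: t => [|t IH] tt going win bN;
  (case: (imaj_or_rival win bN) => [W|[going_t rival]];
   first by eexists; split; eauto).
  (* No steps remain, so [rival] reads [sigma + #|N| <= n], yet both terms exceed [n / 2]. *)
  by exfalso; lia.
(* [rival] gives [sigma <= (n - #|N|) + t.+1]; the strict majority [n - #|N| < #|N|] absorbs the
   lost step. *)
have win' : sigma <= #|N| + t by lia.
have going' t' : t < t' <= tau -> ~~ stopping psi sigma (beta t') t'.
  rewrite leq_eqVlt => /andP[/orP[/eqP<-|lt] le] //.
  by apply: going; rewrite lt.
by apply: IH => //; [lia | apply: step_stay (steps _ tt going')].
Qed.

End Process.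

Theorem theorem2 (R : realType) (C : finType) (psi : C)
  (m n sigma tau : nat)
  (a : 'I_n -> rel C) (u : 'I_n -> scores psi -> nat -> R)
  (hm : 1 <= m) (hC : #|C| = m.+1)
  (ha : forall i, strict_linear_order (a i))
  (hpsi : forall i c, c != psi -> a i c psi)
  (hsigma : n < 2 * sigma) (hsigman : sigma <= n)
  (hu : (forall i, lazy_consistent n sigma tau (a i) (u i)) \/
        (forall i, proactive_consistent n sigma tau (a i) (u i)))
  (c : C) (hc : c != psi)
  (hsc : maxn (n./2 + 1) (sigma - tau)
           <= #|[set i | truthful psi a i == c]|)
  (beta : nat -> profile C n) (hrun : run sigma tau a u beta) :
  terminates_with psi sigma tau beta c.
Proof.
move: hsc; rewrite geq_max => /andP[major win].
(* The induction starts at [tau], where no earlier time exists; the two bounds in the maximum give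
   the majority and the threshold condition. *)
apply: (@terminates_from _ _ _ _ _ _ _ _ ha hu (exist _ c hc)
  [set i | truthful psi a i == c] _ _ beta tau) => //=.
- by move=> i; rewrite inE ffunE => /eqP top_i d; exact: topT_max top_i.
- by move: major; set k := #|_|; lia.
- by move=> t' /andP[lt le]; lia.
- by move: win; set k := #|_|; lia.
- by move=> i; rewrite inE hrun.1 => /eqP.
Qed.
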